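(* Let $S$ be a compact Hausdorff space and let $T\colon C(S)\to C(S)$ be a bounded linear operator. Then $$\max\{\|\mathrm{Id}+T\|,\ \|\mathrm{Id}-T\|\} = 1+\|T\|.$$
   Context: Compact Hausdorff spaces are nonempty. Scalars are real: $C(S)$ is the real Banach space of continuous functions $S\to\mathbb{R}$ with the supremum norm; $\mathrm{Id}$ is the identity operator and operators carry the operator norm. *)

(* Defs.v *)
From HB Require Import structures.
From mathcomp Require Import all_boot all_order all_algebra.
From mathcomp Require Import all_classical all_reals all_analysis.

Set Implicit Arguments.
Unset Strict Implicit.
Unset Printing Implicit Defensive.

Import Order.TTheory GRing.Theory Num.Theory.
Import numFieldNormedType.Exports.

Local Open Scope classical_set_scope.
Local Open Scope ring_scope.

(* C(S). The compactness proof is a parameter of the type because the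
   supremum norm is a norm only on bounded functions. *)
Definition contspace (R : realType) (S : topologicalType)
  (cS : compact [set: S]) : Type := continuousType S R.

Definition contspace_fun (R : realType) (S : topologicalType)
  (cS : compact [set: S]) (f : contspace R cS) : S -> R := Continuous.sort f.
Coercion contspace_fun : contspace >-> Funclass.

Section contspace_normed.
Context {R : realType} {S : topologicalType} {cS : compact [set: S]}.
Local Notation C := (contspace R cS).
Implicit Types f g h : C.

HB.instance Definition _ := Choice.copy C (continuousType S R).

Lemma contspaceP f g : f = g <-> (f : S -> R) =1 g.
Proof. exact: continuousEP. Qed.

Lemma contspace_continuous f : continuous (f : S -> R).
Proof. exact: (@cts_fun _ _ (f : continuousType S R)). Qed.
Arguments contspace_continuous : clear implicits.

Definition contspace_of (f : S -> R) (cf : continuous f) : C :=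
  (mkcts cf : continuousType S R).

Definition contspace_zero : C := contspace_of (@cst_continuous S R 0).

Definition contspace_add f g : C :=
  contspace_of (f := fun x => f x + g x)
    (fun x => continuousD (contspace_continuous f x) (contspace_continuous g x)).

Definition contspace_opp f : C :=
  contspace_of (f := fun x => - f x)
    (fun x => continuousN (contspace_continuous f x)).

Definition contspace_scale (a : R) f : C :=
  contspace_of (f := fun x => a * f x)
    (fun x => continuousZl_tmp (k := a) (contspace_continuous f x)).

Fact contspace_addA : associative contspace_add.
Proof. by move=> f g h; apply/contspaceP => x; exact: addrA. Qed.
Fact contspace_addC : commutative contspace_add.
Proof. by move=> f g; apply/contspaceP => x; exact: addrC. Qed.
Fact contspace_add0 : left_id contspace_zero contspace_add.
Proof. by move=> f; apply/contspaceP => x; exact: add0r. Qed.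
Fact contspace_addN : left_inverse contspace_zero contspace_opp contspace_add.
Proof. by move=> f; apply/contspaceP => x; exact: addNr. Qed.

HB.instance Definition _ := GRing.isZmodule.Build C
  contspace_addA contspace_addC contspace_add0 contspace_addN.

Fact contspace_scaleA a b f :
  contspace_scale a (contspace_scale b f) = contspace_scale (a * b) f.
Proof. by apply/contspaceP => x; exact: mulrA. Qed.
Fact contspace_scale1 : left_id 1 contspace_scale.
Proof. by move=> f; apply/contspaceP => x; exact: mul1r. Qed.
Fact contspace_scaleDr : right_distributive contspace_scale +%R.
Proof. by move=> a f g; apply/contspaceP => x; exact: mulrDr. Qed.
Fact contspace_scaleDl f :
  {morph contspace_scale^~ f : a b / a + b}.
Proof. by move=> a b; apply/contspaceP => x; exact: mulrDl. Qed.

HB.instance Definition _ := GRing.Zmodule_isLmodule.Build R C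
  contspace_scaleA contspace_scale1 contspace_scaleDr contspace_scaleDl.

(* Over an empty S this is sup set0 = 0. *)
Definition contspace_norm f : R := sup [set `|f x| | x in [set: S]].

Lemma contspace_bounded f : has_ubound [set `|f x| | x in [set: S]].
Proof.
have : compact (f @` [set: S]).
  by apply: continuous_compact cS; apply: continuous_subspaceT;
    exact: contspace_continuous.
move=> /compact_bounded/pinfty_ex_gt0[M _ fM].
by exists M => _ [x _ <-]; apply: fM; exists x.
Qed.

Lemma contspace_norm_ub f x : `|f x| <= contspace_norm f.
Proof. by apply: (ub_le_sup (contspace_bounded f)); exists x. Qed.

Lemma contspace_norm_ge0 f : 0 <= contspace_norm f.
Proof.
have [[x _]|S0] := pselect (exists x : S, True).
  exact: le_trans (normr_ge0 _) (contspace_norm_ub f x).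
rewrite /contspace_norm (_ : [set: S] = set0) ?image_set0 ?sup0//.
by apply/seteqP; split => // x _; apply: S0; exists x.
Qed.

Lemma contspace_norm_le f (M : R) :
  0 <= M -> (forall x, `|f x| <= M) -> contspace_norm f <= M.
Proof.
move=> M0 fM; have [[x _]|S0] := pselect (exists x : S, True).
  by apply: ge_sup => [|_ [y _ <-]//]; exists `|f x|, x.
rewrite /contspace_norm (_ : [set: S] = set0) ?image_set0 ?sup0//.
by apply/seteqP; split => // x _; apply: S0; exists x.
Qed.

Fact contspace_ler_normD f g :
  contspace_norm (f + g) <= contspace_norm f + contspace_norm g.
Proof.
apply: contspace_norm_le => [|x]; first by rewrite addr_ge0// contspace_norm_ge0.
by apply: le_trans (ler_normD _ _) _; apply: lerD; exact: contspace_norm_ub.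
Qed.

Fact contspace_norm_eq0 f : contspace_norm f = 0 -> f = 0.
Proof.
move=> f0; apply/contspaceP => x; apply/eqP; rewrite -normr_le0 -f0.
exact: contspace_norm_ub.
Qed.

Fact contspace_normZ a f : contspace_norm (a *: f) = `|a| * contspace_norm f.
Proof.
have leZ b g : contspace_norm (b *: g) <= `|b| * contspace_norm g.
  apply: contspace_norm_le => [|x]; first by rewrite mulr_ge0// contspace_norm_ge0.
  rewrite [X in `|X|](_ : _ = b * g x)// normrM.
  by rewrite ler_wpM2l// contspace_norm_ub.
apply/eqP; rewrite eq_le leZ/=.
have [->|a0] := eqVneq a 0; first by rewrite normr0 mul0r contspace_norm_ge0.
rewrite -ler_pdivlMl ?normr_gt0// -normfV.
by rewrite -{1}(scale1r f) -(mulVf a0) -scalerA leZ.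
Qed.

HB.instance Definition _ := Lmodule_isNormed.Build R C
  contspace_ler_normD contspace_normZ contspace_norm_eq0.

End contspace_normed.

(* Meaningful for bounded T; sup of an unbounded set is 0. *)
Definition opnorm (R : realType) (V W : normedModType R)
    (T : {linear V -> W}) : R :=
  sup [set `|T f| | f in [set f : V | `|f| <= 1]].

(* Main.v *)
Require Import Defs.
From HB Require Import structures.
From mathcomp Require Import all_boot all_order all_algebra.
From mathcomp Require Import all_classical all_reals all_analysis.
From mathcomp Require Import ring lra.

Set Implicit Arguments.
Unset Strict Implicit.
Unset Printing Implicit Defensive.

Import Order.TTheory GRing.Theory Num.Theory.
Import numFieldNormedType.Exports.

Local Open Scope classical_set_scope.
Local Open Scope ring_scope.

(** The inequality [<=] is the triangle inequality.  For [>=], fix a point [s]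
and consider the functional [phi := fun f => T f s].  If [mu] is the signed
measure representing [phi], then [delta_s + mu] has norm [1 + |mu|] when
[mu {s} >= 0], and [delta_s - mu] does when [mu {s} <= 0]; so at each single
point one of the two signs already works.

This argument has a version without measures.  Given [f] in the unit ball, let [u]
be a bump function with values in [[0, 1]] and [u s = 1], so concentrated on
the set where [f] is close to [f s] that [u (f - f s)] is uniformly small.
Replacing [f] near [s] by a sign [sigma], that is taking
[g := (1 - u) f + sigma u], gives an element of the unit ball with
[g s = sigma] and
[phi g = phi f + (sigma - f s) phi u - phi (u (f - f s))].
If [sigma] is the sign of [phi u], the middle term is nonnegative because
[|f s| <= 1], hence [phi g] is at least [phi f] up to a small error
([functional_ball_unimodular_at]).  When [g s = 1] the value of [g + T g] at
[s] is at least about [1 + T f s]; when [g s = -1] the same holds for the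
value of [T g - g].  Taking the supremum over [f] and [s] concludes. *)

Section operator_norm.
Context {R : realType} {V W : normedModType R}.
Implicit Type T : {linear V -> W}.

Lemma opnorm_ub T (M : R) (f : V) :
  (forall g : V, `|T g| <= M * `|g|) -> `|f| <= 1 -> `|T f| <= opnorm T.
Proof.
move=> TM f1; apply: ub_le_sup; last by exists f.
exists `|M| => _ [g /= g1 <-]; apply: le_trans (TM g) _.
by rewrite (le_trans (ler_wpM2r _ (ler_norm M)))// ler_piMr.
Qed.

Lemma opnorm_le T (M : R) :
  (forall f : V, `|f| <= 1 -> `|T f| <= M) -> opnorm T <= M.
Proof.
move=> TM; apply: ge_sup => [|_ [f /= f1 <-]]; last exact: TM.
by exists `|T 0|, 0 => //=; rewrite normr0.
Qed.

End operator_norm.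

Section continuous_functions.
Context {R : realType} {S : topologicalType} {cS : compact [set: S]}.
Local Notation C := (contspace R cS).

Lemma normr_contspace_ub (f : C) s : `|f s| <= `|f|.
Proof. exact: contspace_norm_ub. Qed.

Lemma normr_contspace_le (f : C) (M : R) :
  0 <= M -> (forall s, `|f s| <= M) -> `|f| <= M.
Proof. exact: contspace_norm_le. Qed.

Definition contspace_eval (s : S) (f : C) : R := f s.

Fact contspace_eval_scalar s : scalar (contspace_eval s).
Proof. by []. Qed.

HB.instance Definition _ s :=
  GRing.isLinear.Build R C R *%R (contspace_eval s) (contspace_eval_scalar s).

(** The bump [u = d / (d + |f - f s|)] works: building it from [f] itself makes
the oscillation of [f] weighted by [u] small on the whole space at once. *)
Lemma exists_bump_at (f : C) (s : S) (d : R) : 0 < d ->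
  exists u v : C, [/\ u s = 1, forall t, 0 <= u t <= 1,
    forall t, v t = u t * (f t - f s) & `|v| <= d].
Proof.
move=> d0.
have p0 t : 0 < d + `|f t - f s| by rewrite ltr_pwDl.
have cw : continuous (fun t => f t - f s).
  by move=> t; apply: cvgB; [exact: contspace_continuous|exact: cvg_cst].
have cu : continuous (fun t => d * (d + `|f t - f s|)^-1).
  move=> t; apply: cvgM; first exact: cvg_cst.
  apply: cvgV; first exact: lt0r_neq0.
  by apply: cvgD; [exact: cvg_cst|apply: cvg_norm; exact: cw].
have cv : continuous (fun t => d * (d + `|f t - f s|)^-1 * (f t - f s)).
  by move=> t; apply: cvgM; [exact: cu|exact: cw].
pose u : C := contspace_of cu; pose v : C := contspace_of cv.
have uE t : u t = d * (d + `|f t - f s|)^-1 by [].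
have vE t : v t = d * (d + `|f t - f s|)^-1 * (f t - f s) by [].
exists u, v; split => [|t|//|].
- by rewrite uE subrr normr0 addr0 divff// gt_eqF.
- by rewrite uE divr_ge0 ?(ltW d0) ?(ltW (p0 t))//= ler_pdivrMr// mul1r lerDl.
- apply: normr_contspace_le => [|t]; first exact: ltW.
  rewrite vE !normrM normfV (gtr0_norm d0) (gtr0_norm (p0 t)).
  rewrite -mulrA ler_piMr ?(ltW d0)// mulrC ler_pdivrMr// mul1r.
  by rewrite lerDr ltW.
Qed.

(** Modifying [f] near [s] so that it takes there the sign of [phi u] for the
bump [u] cannot decrease [phi] by more than the arbitrarily small error coming
from the oscillation of [f] on the bump. *)
Lemma functional_ball_unimodular_at (phi : {scalar C}) (M : R) (f : C) (s : S)
    (e : R) :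
  (forall g : C, `|phi g| <= M * `|g|) -> `|f| <= 1 -> 0 < e ->
  exists g : C, [/\ `|g| <= 1, g s = 1 \/ g s = -1 & phi f - e <= phi g].
Proof.
move=> phiM f1 e0.
(* [|M| + 1] replaces the bound [M], which may vanish, as a divisor of [e]. *)
have N0 : 0 < `|M| + 1 by rewrite ltr_wpDl.
have [u [v [us u01 vE vd]]] := exists_bump_at f s (divr_gt0 e0 N0).
have phiv : `|phi v| <= e.
  apply: le_trans (phiM v) _; rewrite -(@divfK _ (`|M| + 1) _ e) ?gt_eqF//.
  rewrite [leRHS]mulrC; apply: (@le_trans _ _ ((`|M| + 1) * `|v|)).
    by rewrite ler_wpM2r// (le_trans (ler_norm M))// lerDl.
  by rewrite ler_wpM2l// ltW.
have f1t t : `|f t| <= 1 := le_trans (normr_contspace_ub f t) f1.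
have [sg [sgE sgphi]] : exists sg : R, (sg = 1 \/ sg = -1) /\
    sg * phi u = `|phi u|.
  have [p|n] := leP 0 (phi u).
    by exists 1; split; [left|rewrite mul1r ger0_norm].
  by exists (-1); split; [right|rewrite mulN1r ltr0_norm].
pose g : C := f + (sg - f s) *: u - v.
(* [g t] is a convex combination of [f t] and [sg], hence stays in the ball. *)
have gE t : g t = (1 - u t) * f t + u t * sg.
  rewrite [LHS](_ : _ = f t + (sg - f s) * u t - v t)// vE; ring.
exists g; split.
- apply: normr_contspace_le => // t; rewrite gE.
  have /andP[u0 u1] := u01 t; have := f1t t; rewrite !ler_norml => /andP[a b].
  by case: sgE => ->; apply/andP; split; nra.
- by rewrite gE us subrr mul0r add0r mul1r.
- rewrite /g linearB linearD linearZ/= mulrBl sgphi.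
  have : f s * phi u <= `|phi u|.
    by rewrite (le_trans (ler_norm _))// normrM ler_piMl.
  move: phiv; rewrite ler_norml => /andP[_]; lra.
Qed.

End continuous_functions.

Theorem proposition1 (R : realType) (S : topologicalType)
    (S0 : [set: S] !=set0) (cS : compact [set: S]) (hS : hausdorff_space S)
    (T : {linear contspace R cS -> contspace R cS})
    (bT : exists M : R, forall f : contspace R cS, `|T f| <= M * `|f|) :
  Num.max (opnorm (idfun \+ T)) (opnorm (idfun \- T)) = 1 + opnorm T.
Proof.
have [M TM] := bT; set m := Num.max _ _.
have pM (f : contspace R cS) : `|(idfun \+ T) f| <= (1 + M) * `|f|.
  by rewrite /= mulrDl mul1r (le_trans (ler_normD _ _))// lerD2l.
have nM (f : contspace R cS) : `|(idfun \- T) f| <= (1 + M) * `|f|.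
  by rewrite /= mulrDl mul1r (le_trans (ler_normB _ _))// lerD2l.
apply/eqP; rewrite eq_le; apply/andP; split.
  rewrite ge_max; apply/andP; split; apply: opnorm_le => f f1 /=.
    by rewrite (le_trans (ler_normD _ _))// lerD// (opnorm_ub TM).
  by rewrite (le_trans (ler_normB _ _))// lerD// (opnorm_ub TM).
have key (f : contspace R cS) s : `|f| <= 1 -> 1 + T f s <= m.
  move=> f1; apply/ler_addgt0Pr => e e0.
  have phiM (g : contspace R cS) : `|(contspace_eval s \o T) g| <= M * `|g|.
    exact: le_trans (normr_contspace_ub _ _) (TM g).
  have [g [g1 gs]] := functional_ball_unimodular_at s phiM f1 e0.
  rewrite -[_ g]/(T g s) -[_ f]/(T f s) => Tg.
  suff : 1 + T g s <= m by lra.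
  rewrite le_max; apply/orP; case: gs => gs; [left|right].
    apply: le_trans (opnorm_ub pM g1).
    apply: le_trans (normr_contspace_ub _ s).
    by rewrite [leRHS](_ : _ = `|g s + T g s|)// gs ler_norm.
  apply: le_trans (opnorm_ub nM g1).
  apply: le_trans (normr_contspace_ub _ s).
  by rewrite [leRHS](_ : _ = `|g s - T g s|)// gs -opprD normrN ler_norm.
have m1 : 1 <= m.
  have [s _] := S0; have := key 0 s.
  by rewrite linear0 normr0 [X in 1 + X](_ : _ = 0)// addr0; apply.
rewrite addrC -lerBrDr; apply: opnorm_le => f f1.
apply: normr_contspace_le => [|s]; first by rewrite subr_ge0.
rewrite ler_norml lerNl !lerBrDl key// andbT.
have := key (- f) s; rewrite normrN => /(_ f1).
by rewrite linearN.
Qed.
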